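(* There is a polynomial-time algorithm that, given an orientation $\vec{G}$ of a graph $G$, decides whether there exist an integer $q$ and a $q$-colouring $f$ of $G$ such that $(\vec{G},f)$ is a $q$-coloured MINI-orientation of $G$.
   Context: A $q$-colouring of $G$ is a map $V(G)\to\mathbb{Z}_q$ assigning distinct colours to adjacent vertices. $(\vec{G},f)$ is a $q$-coloured MINI-orientation if $f$ is a $q$-colouring and for every vertex $v$: (i) no out-neighbour of $v$ has the same colour as an in-neighbour of $v$; (ii) the out-neighbours of $v$ have pairwise distinct colours; (iii) all in-neighbours of $v$ have the same colour. *)

(* Defs.v *)
From HB Require Import structures.
From mathcomp Require Import all_boot all_order all_algebra.

Set Implicit Arguments.
Unset Strict Implicit.
Unset Printing Implicit Defensive.

Record sgraph (V : finType) := SGraph {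
  adj : rel V;
  adj_sym : symmetric adj;
  adj_irrefl : irreflexive adj
}.

Record orientation (V : finType) (G : sgraph V) := Orientation {
  arc : rel V;
  arc_adj : forall u v, arc u v -> adj G u v;
  arc_exactly_one : forall u v, adj G u v -> arc u v (+) arc v u
}.

(* The colour set Z_q is represented by 'I_q, whose elements are the residues
   0, ..., q-1 (the ring 'Z_q is not used because 'Z_1 has two elements). *)
Definition is_colouring (V : finType) (G : sgraph V) (q : nat)
    (f : V -> 'I_q) : Prop :=
  forall u v, adj G u v -> f u <> f v.

Record coloured_MINI (V : finType) (G : sgraph V) (D : orientation G)
    (q : nat) (f : V -> 'I_q) : Prop := ColouredMINI {
  MINI_colouring : is_colouring G f;
  MINI_out_in : forall v u w, arc D v u -> arc D w v -> f u <> f w;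
  MINI_out_out : forall v u w, arc D v u -> arc D v w -> u <> w -> f u <> f w;
  MINI_in_in : forall v u w, arc D u v -> arc D w v -> f u = f w
}.

(* Random access machines with countably many registers and an indirectly
   addressed memory, all holding natural numbers.  Each instruction takes one
   time step.  Addition and truncated subtraction are the only arithmetic
   operations, so the bit length of the largest stored number grows by at most
   one per step (up to a constant depending on the program); hence time on these
   machines is polynomially related to time on Turing machines. *)
Inductive instr : Type :=
| Const (r k : nat)     (* R[r] := k *)
| Add (r a b : nat)     (* R[r] := R[a] + R[b] *)
| Sub (r a b : nat)     (* R[r] := R[a] - R[b], truncated at 0 *)
| Read (r a : nat)      (* R[r] := M[R[a]] *)
| Write (a b : nat)     (* M[R[a]] := R[b] *)
| JumpZ (a l : nat).    (* if R[a] = 0 then continue at instruction l *)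

Definition program := seq instr.

Record config := Config { pc : nat; reg : nat -> nat; mem : nat -> nat }.

Definition exec (i : instr) (c : config) : config :=
  let: Config l R M := c in
  match i with
  | Const r k => Config l.+1 [eta R with r |-> k] M
  | Add r a b => Config l.+1 [eta R with r |-> R a + R b] M
  | Sub r a b => Config l.+1 [eta R with r |-> R a - R b] M
  | Read r a => Config l.+1 [eta R with r |-> M (R a)] M
  | Write a b => Config l.+1 R [eta M with R a |-> R b]
  | JumpZ a l' => Config (if R a == 0 then l' else l.+1) R M
  end.

(* The machine halts when the program counter leaves the program; a halted
   configuration is a fixed point of [step]. *)
Definition halted (p : program) (c : config) : bool := size p <= pc c.

Definition step (p : program) (c : config) : config :=
  if onth p (pc c) is Some i then exec i c else c.

(* The input word is in memory, one bit per cell from address 0 on; register 0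
   holds its length; everything else is 0. *)
Definition init (x : bitseq) : config :=
  Config 0 [eta (fun=> 0) with 0 |-> size x] (fun i => nth false x i).

Definition halts_within (p : program) (x : bitseq) (t : nat) (c : config) :=
  exists k, [/\ k <= t, c = iter k (step p) (init x) & halted p c].

(* A halting computation accepts iff register 0 is nonzero. *)
Definition accepting (c : config) : bool := reg c 0 != 0.

Definition poly_time_decidable (X : Type) (enc : X -> bitseq) (P : X -> Prop) :
    Prop :=
  exists (p : program) (t : {poly nat}), forall x : X,
    exists c, halts_within p (enc x) t.[size (enc x)]%R c /\
              (accepting c <-> P x).

Record oriented_graph := OrientedGraph {
  nverts : nat;
  ugraph : sgraph 'I_nverts;
  orient : orientation ugraph
}.

(* The word 1^n 0 followed by the n^2 entries of the adjacency matrix of the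
   digraph, row by row. *)
Definition encode (D : oriented_graph) : bitseq :=
  nseq (nverts D) true ++ false ::
    [seq arc (orient D) u v | u <- enum 'I_(nverts D), v <- enum 'I_(nverts D)].

(* Main.v *)
(* In a colouring with the MINI property all in-neighbours of a vertex share a
   colour, so every such colouring is constant on the classes of the equivalence
   relation generated by "u and w have a common out-neighbour".  All other
   requirements ask certain colours to be different, hence they hold for some
   colouring as soon as they hold for the finest one, whose colours are these
   classes.  The algorithm labels the vertices by themselves, merges the labels of
   u and w for every v with u -> v <- w (one pass over all triples is enough, since
   a relabelling never separates two equal labels), and then looks for a triple
   violating one of the inequality requirements. *)
Require Import Defs.
From mathcomp Require Import all_boot all_order all_algebra.
From mathcomp Require Import zify.
(* MathComp shadows [mem] and [Sub]. *)
Import Defs.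

Set Implicit Arguments.
Unset Strict Implicit.
Unset Printing Implicit Defensive.

(** * A structured language compiled to the machine *)

Inductive cmd : Type :=
| Block (q : seq instr)
| Seq (c d : cmd)
| If (a : nat) (c : cmd)
| For (b i : nat) (c : cmd).

(* The compiled loops use this register as scratch: it holds 0 for their
   unconditional back jump and 1 for decrementing the counter. *)
Notation rz := 2 (only parsing).

(** [l] is the address at which the code is loaded; jump targets are absolute. *)
Fixpoint compile (l : nat) (c : cmd) : program :=
  match c with
  | Block q => q
  | Seq c d => let p := compile l c in p ++ compile (l + size p) d
  | If a c => let p := compile l.+1 c in JumpZ a (l.+1 + size p) :: p
  | For b i c =>
      let p := compile l.+1.+4 c in
      [:: Const rz 0; Add i b rz; JumpZ i (l.+1.+4 + size p + 2); Const rz 1;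
          Sub i i rz] ++ p ++ [:: Const rz 0; JumpZ rz l.+2]
  end.

Definition dest (i : instr) : seq nat :=
  match i with
  | Const r _ | Add r _ _ | Sub r _ _ | Read r _ => [:: r]
  | _ => [::]
  end.

Definition is_jump (i : instr) : bool := if i is JumpZ _ _ then true else false.
Definition is_write (i : instr) : bool := if i is Write _ _ then true else false.

Fixpoint writes (c : cmd) : seq nat :=
  match c with
  | Block q => flatten (map dest q)
  | Seq c d => writes c ++ writes d
  | If _ c => writes c
  | For _ i c => [:: i, rz & writes c]
  end.

Fixpoint keeps_mem (c : cmd) : bool :=
  match c with
  | Block q => ~~ has is_write q
  | Seq c d => keeps_mem c && keeps_mem d
  | If _ c | For _ _ c => keeps_mem c
  end.

(** One register [b] bounds all loops. As long as it is never written, a single number bounds every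
    iteration count, and the running time is a polynomial in that number. *)
Fixpoint wf (b : nat) (c : cmd) : bool :=
  match c with
  | Block q => ~~ has is_jump q
  | Seq c d => wf b c && wf b d
  | If _ c => wf b c
  | For b' i c => [&& b' == b, b != rz, i != rz, i \notin writes c & wf b c]
  end.

(** The scratch writes of a loop are reproduced exactly, so that all registers agree with those of
    the compiled code. The program counter of the result carries no meaning. *)
Fixpoint sem (c : cmd) (s : config) : config :=
  match c with
  | Block q => foldl (fun s i => exec i s) s q
  | Seq c d => sem d (sem c s)
  | If a c => if reg s a == 0 then s else sem c s
  | For b i c =>
      iter (reg s b)
        (fun s => exec (Const rz 0) (sem c (exec (Sub i i rz) (exec (Const rz 1) s))))
        (exec (Add i b rz) (exec (Const rz 0) s))
  end.

(** The variable stands for a bound on the loop register. Besides its body, a round costs five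
    instructions: the test, two for the decrement, two for the back jump. Three more set up the
    counter and make the last test. *)
Fixpoint time (c : cmd) : {poly nat} :=
  match c with
  | Block q => (size q)%:P
  | Seq c d => time c + time d
  | If _ c => 1%:P + time c
  | For _ _ c => (time c + 5%:P) * 'X + 3%:P
  end%R.

(** * Simulation of commands by compiled code, and proof rules for loops *)

Definition setpc (l : nat) (s : config) : config := Config l (reg s) (mem s).

Lemma exec_setpc i l s :
  ~~ is_jump i -> exec i (setpc l s) = setpc l.+1 (exec i s).
Proof. by case: i => //= *; case: s. Qed.

Lemma exec_frame i s r : r \notin dest i -> reg (exec i s) r = reg s r.
Proof. by case: s => l R M; case: i => [r' k|r' a b|r' a b|r' a|a b|a l'] //=; rewrite inE => /negPf->. Qed.

Lemma exec_mem i s : ~~ is_write i -> mem (exec i s) = mem s.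
Proof. by case: s => l R M; case: i. Qed.

Lemma sem_frame c s r : r \notin writes c -> reg (sem c s) r = reg s r.
Proof.
elim: c s => [q|c IHc d IHd|a c IHc|b i c IHc] s /=.
- elim: q s => //= i q IHq s; rewrite mem_cat negb_or => /andP[ri rq].
  by rewrite IHq // exec_frame.
- by rewrite mem_cat negb_or => /andP[rc rd]; rewrite IHd // IHc.
- by case: ifP => // _; apply: IHc.
rewrite !inE !negb_or => /and3P[ri rz rc].
elim: (reg s b) => [|n IHn]; first by rewrite !exec_frame ?inE.
by rewrite iterS exec_frame ?inE // IHc // !exec_frame ?inE.
Qed.

Lemma sem_mem c s : keeps_mem c -> mem (sem c s) = mem s.
Proof.
elim: c s => [q|c IHc d IHd|a c IHc|b i c IHc] s /=.
- elim: q s => //= i q IHq s; rewrite negb_or => /andP[ri rq].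
  by rewrite IHq // exec_mem.
- by move=> /andP[rc rd]; rewrite IHd // IHc.
- by case: ifP => // _; apply: IHc.
move=> /= cP; elim: (reg s b) => [|n IHn]; first by rewrite !exec_mem.
by rewrite iterS exec_mem // IHc // !exec_mem.
Qed.

Definition code_at (p : program) (l : nat) (q : program) :=
  forall j i, onth q j = Some i -> onth p (l + j) = Some i.

Lemma code_at_cons p l i q :
  code_at p l (i :: q) -> onth p l = Some i /\ code_at p l.+1 q.
Proof.
move=> h; split; first by have := h 0 i erefl; rewrite addn0.
by move=> j k jk; rewrite addSnnS; apply: h.
Qed.

Lemma code_at_cat p l q1 q2 :
  code_at p l (q1 ++ q2) -> code_at p l q1 /\ code_at p (l + size q1) q2.
Proof.
elim: q1 l => [|i q1 IH] l /=; first by rewrite addn0; split=> //; case.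
move=> /code_at_cons[hi /IH[h1 h2]]; rewrite addnS -addSn; split=> //.
case=> [|j] k /= jk; first by rewrite addn0 -jk.
by rewrite -addSnnS; apply: h1.
Qed.

Definition reaches (p : program) (t : nat) (s s' : config) :=
  exists2 k, k <= t & iter k (step p) s = s'.

Lemma reaches0 p s t : reaches p t s s.
Proof. by exists 0. Qed.

Lemma reaches_trans p s1 s2 s3 t1 t2 t :
  reaches p t1 s1 s2 -> reaches p t2 s2 s3 -> t1 + t2 <= t -> reaches p t s1 s3.
Proof.
move=> [k1 h1 <-] [k2 h2 <-] ht; exists (k2 + k1); last by rewrite iterD.
by apply: leq_trans ht; rewrite addnC leq_add.
Qed.

Lemma reaches_step p l s i s' t :
  onth p l = Some i -> reaches p t (exec i (setpc l s)) s' ->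
  reaches p t.+1 (setpc l s) s'.
Proof.
move=> hi h; apply: (reaches_trans (t1 := 1) _ h) => //.
by exists 1 => //=; rewrite /step /= hi.
Qed.

(** Induction on the command. Since [b] is never written, the bound [m] remains valid in every
    intermediate state, hence also for nested loops. *)
Lemma compile_correct p b c l s m :
  wf b c -> b \notin writes c -> code_at p l (compile l c) -> reg s b <= m ->
  reaches p (time c).[m]%R (setpc l s) (setpc (l + size (compile l c)) (sem c s)).
Proof.
elim: c l s => [q|c IHc d IHd|a c IHc|b' i c IHc] l s /=.
- rewrite hornerC => + _ + _; elim: q l s => [|i q IHq] l s /=.
    by rewrite addn0 => _ _; apply: reaches0.
  rewrite negb_or => /andP[hi hq] /code_at_cons[pi pq].
  by apply: reaches_step pi _; rewrite exec_setpc // addnS -addSn; apply: IHq.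
- rewrite mem_cat negb_or => /andP[wc wd] /andP[bc bd] /code_at_cat[pc pd] bm.
  rewrite hornerD size_cat addnA.
  apply: reaches_trans (IHc _ _ wc bc pc bm) (IHd _ _ wd bd pd _) (leqnn _).
  by rewrite sem_frame.
- move=> wc bc /code_at_cons[pj pc] bm; rewrite hornerD hornerC.
  apply: reaches_step pj _ => /=; case: ifP => _ /=.
    by rewrite addSnnS; apply: reaches0.
  by rewrite -addSnnS; apply: IHc.
move=> /and5P[/eqP-> bz iz ic wc]; rewrite !inE !negb_or => /and3P[bi _ bc].
move=> /code_at_cons[p0 /code_at_cons[p1 /code_at_cons[p2 /code_at_cons[p3]]]].
move=> /code_at_cons[p4]; move=> /code_at_cat[pc].
move=> /code_at_cons[p5 /code_at_cons[p6 _]] bm.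
rewrite hornerD hornerMX hornerD !hornerC.
set F := fun s0 => exec (Const rz 0) _; set T := (time c).[m]%R.
set e := (X in setpc X (iter _ _ _)); have {}p2 : onth p l.+2 = Some (JumpZ i e).
  rewrite p2; congr (Some (JumpZ i _)); rewrite /e size_cat /=; lia.
(* [l.+2] is the address of the loop test; the final [+ 1] pays for the test that leaves the
   loop. *)
have loop n s1 : reg s1 i = n -> reg s1 b <= m ->
    reaches p (n * (T + 5) + 1) (setpc l.+2 s1) (setpc e (iter n F s1)).
  elim: n s1 => [|n IHn] s1 s1i s1b; rewrite addn1; apply: reaches_step p2 _ => /=.
    by rewrite s1i; apply: reaches0.
  rewrite s1i /=; rewrite [_ * _](_ : _ = (T + (n * (T + 5) + 1).+2).+2); last lia.
  apply: reaches_step p3 _; rewrite exec_setpc //.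
  apply: reaches_step p4 _; rewrite exec_setpc //.
  have s2i : reg (exec (Sub i i rz) (exec (Const rz 1) s1)) i = n.
    by case: s1 s1i {s1b} => ? ? ? /=; rewrite !eqxx (negPf iz) => ->; rewrite subn1.
  have s2b : reg (exec (Sub i i rz) (exec (Const rz 1) s1)) b <= m.
    by rewrite !exec_frame ?inE.
  apply: reaches_trans (IHc _ _ wc bc pc s2b) _ (leqnn _).
  apply: reaches_step p5 _; rewrite exec_setpc //.
  apply: reaches_step p6 _.
  set s2 := exec (Sub _ _ _) _ in s2i s2b *.
  (* The back jump is taken because [rz] has just been set to 0. *)
  rewrite [exec (JumpZ _ _) _](_ : _ = setpc l.+2 (F s1)); last first.
    by rewrite /F -/s2; case: (sem c s2).
  by rewrite -iterS iterSr; apply: IHn; rewrite ?exec_frame ?inE ?sem_frame.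
have s1i : reg (exec (Add i b rz) (exec (Const rz 0) s)) i = reg s b.
  by case: s {bm} => ? ? ? /=; rewrite !eqxx (negPf bz) addn0.
rewrite [(_ + 3)%R](_ : _ = (m * (T + 5) + 1).+2); last by rewrite mulnC; lia.
apply: reaches_step p0 _; rewrite exec_setpc //.
apply: reaches_step p1 _; rewrite exec_setpc //.
apply: reaches_trans (loop _ _ s1i _) (reaches0 p _ 0) _.
  by rewrite !exec_frame ?inE.
by rewrite addn0 leq_add2r leq_mul2r bm orbT.
Qed.

(* The loop counter runs downwards, and the body sees it already decremented;
   [P k] is the invariant once the indices k and above have been treated. *)
Lemma for_ind b i c (T : Type) (o : config -> T) (P : nat -> T -> Prop) s :
  wf b (For b i c) -> b \notin writes c ->
  (forall s1 s2, mem s1 = mem s2 ->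
     (forall r, r != i -> r != rz -> reg s1 r = reg s2 r) -> o s1 = o s2) ->
  P (reg s b) (o s) ->
  (forall k s1, k < reg s b -> reg s1 i = k ->
     (forall r, r \notin i :: rz :: writes c -> reg s1 r = reg s r) ->
     (keeps_mem c -> mem s1 = mem s) ->
     P k.+1 (o s1) -> P k (o (sem c s1))) ->
  P 0 (o (sem (For b i c) s)).
Proof.
move=> /= /and5P[_ bz iz ic wc] bc ho P0 Pstep.
set F := fun s0 => exec (Const rz 0) _; set s0 := exec (Add i b rz) _.
(* The bookkeeping of the loop changes only [i] and [rz], to which [o] is insensitive. *)
have oF s1 k : o (exec (Const rz k) s1) = o s1.
  apply: ho => [|r _ rz']; first by rewrite exec_mem.
  by rewrite exec_frame ?inE.
have oS s1 : o (exec (Sub i i rz) s1) = o s1.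
  apply: ho => [|r ri _]; first by rewrite exec_mem.
  by rewrite exec_frame ?inE.
have s0i : reg s0 i = reg s b.
  by rewrite /s0; case: (s) => ? ? ? /=; rewrite !eqxx (negPf bz) addn0.
suff main n s1 : n <= reg s b -> reg s1 i = n ->
     (forall r, r \notin i :: rz :: writes c -> reg s1 r = reg s r) ->
     (keeps_mem c -> mem s1 = mem s) -> P n (o s1) -> P 0 (o (iter n F s1)).
  apply: main => //.
  - by move=> r; rewrite !inE !negb_or => /and3P[ri rz _]; rewrite !exec_frame ?inE.
  - by move=> _; rewrite !exec_mem.
  rewrite (_ : o s0 = o s) // /s0 -(oF s 0); apply: ho => [|r ri _].
    by rewrite exec_mem.
  by rewrite exec_frame ?inE.
elim: n s1 => // n IHn s1 ns s1i fr km; rewrite iterSr => Ps1.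
have s2i : reg (exec (Sub i i rz) (exec (Const rz 1) s1)) i = n.
  by case: (s1) s1i => ? ? ? /=; rewrite !eqxx (negPf iz) => ->; rewrite subn1.
apply: IHn; first exact: ltnW.
- by rewrite exec_frame ?inE // sem_frame.
- move=> r rn; rewrite -fr //; move: rn; rewrite !inE !negb_or => /and3P[ri rz rc].
  by rewrite !exec_frame ?inE // sem_frame // !exec_frame ?inE.
- by move=> kc; rewrite exec_mem // sem_mem // !exec_mem // km.
rewrite oF; apply: Pstep => //; last by rewrite oS oF.
  move=> r rn; rewrite -fr //; move: rn; rewrite !inE !negb_or => /and3P[ri rz rc].
  by rewrite !exec_frame ?inE.
by move=> kc; rewrite !exec_mem // km.
Qed.

(** The observation moves along the preorder [le], and [Q] persists along it; what iteration [k]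
    establishes therefore still holds when the loop ends. *)
Lemma for_all b i c (T : Type) (o : config -> T) (le : T -> T -> Prop)
    (Q : nat -> T -> Prop) s :
  wf b (For b i c) -> b \notin writes c ->
  (forall s1 s2, mem s1 = mem s2 ->
     (forall r, r != i -> r != rz -> reg s1 r = reg s2 r) -> o s1 = o s2) ->
  (forall x, le x x) -> (forall y x z, le x y -> le y z -> le x z) ->
  (forall k x y, Q k x -> le x y -> Q k y) ->
  (forall k s1, k < reg s b -> reg s1 i = k ->
     (forall r, r \notin i :: rz :: writes c -> reg s1 r = reg s r) ->
     (keeps_mem c -> mem s1 = mem s) ->
     le (o s) (o s1) -> le (o s1) (o (sem c s1)) /\ Q k (o (sem c s1))) ->
  le (o s) (o (sem (For b i c) s)) /\
  forall k, k < reg s b -> Q k (o (sem (For b i c) s)).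
Proof.
move=> wfc bc ho lexx letr Qle step.
pose P n x := le (o s) x /\ forall k, n <= k < reg s b -> Q k x.
suff : P 0 (o (sem (For b i c) s)) by [].
apply: for_ind => //; first by split=> // k; lia.
move=> k s1 kb s1i fr km [le1 Q1]; have [le2 Q2] := step k s1 kb s1i fr km le1.
split=> [|k']; first exact: letr le2.
case: (eqVneq k k') => [<- //|kk' /andP[k1 k2]].
by apply: Qle le2; apply: Q1; lia.
Qed.

(** * The algorithm *)

(* Registers: 0 is the length of the input and finally the verdict; 1 is the number
   n of vertices; 3, 4, 5 are the vertices v, u, w; 6 is the vertex being
   relabelled; 7, 8, 9 are scratch; 17 is the verdict so far; the others hold
   operands.  The label of u is stored in the first free memory, at address
   (length of the input) + u. *)

(* As the loop runs downwards, the last zero it meets is the first zero of the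
   word 1^n 0 ... *)
Definition find_order : cmd :=
  For 0 3 (Seq (Block [:: Read 10 3; Const 9 1; Sub 10 9 10])
               (If 10 (Block [:: Const rz 0; Add 1 3 rz]))).

(* There is no multiplication: the row offset u * n is summed up in a loop. *)
Definition load_arc (r u v : nat) : cmd :=
  Seq (Block [:: Const 7 0])
 (Seq (For 1 8 (Block [:: Add 7 7 u]))
      (Block [:: Add 7 7 1; Add 7 7 v; Const 9 1; Add 7 7 9; Read r 7])).

Definition load_label (r u : nat) : cmd := Block [:: Add 7 u 0; Read r 7].

Definition init_labels : cmd := For 1 4 (Block [:: Add 7 4 0; Write 7 4]).

(** With truncated subtraction, (x - y) + (y - x) vanishes exactly when x = y; subtracting it from 1
    gives a flag that is nonzero exactly for equal labels. *)
Definition relabel : cmd :=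
  For 1 6
    (Seq (load_label 14 6)
    (Seq (Block [:: Sub 15 14 13; Sub 16 13 14; Add 15 15 16; Const 9 1; Sub 15 9 15])
         (If 15 (Block [:: Write 7 12])))).

Definition merge : cmd :=
  Seq (load_arc 10 4 3) (Seq (load_arc 11 5 3)
    (If 10 (If 11 (Seq (load_label 12 4) (Seq (load_label 13 5) relabel))))).

Definition refute : cmd := Block [:: Const 17 0].

(** Registers 10, 11, 18, 19 hold the entries for u -> w, v -> u, w -> v, v -> w; 15 flags equal
    labels and 20 distinct vertices u, w. *)
Definition check : cmd :=
  Seq (load_arc 10 4 5) (Seq (load_arc 11 3 4) (Seq (load_arc 18 5 3)
 (Seq (load_arc 19 3 5) (Seq (load_label 12 4) (Seq (load_label 13 5)
 (Seq (Block [:: Sub 15 12 13; Sub 16 13 12; Add 15 15 16; Const 9 1; Sub 15 9 15;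
                 Sub 20 4 5; Sub 21 5 4; Add 20 20 21])
      (If 15 (Seq (If 10 refute)
         (If 11 (Seq (If 18 refute) (If 19 (If 20 refute)))))))))))).

Definition for3 (c : cmd) : cmd := For 1 3 (For 1 4 (For 1 5 c)).

Definition decide : cmd :=
  Seq init_labels
 (Seq (for3 merge)
 (Seq (Block [:: Const 17 1])
 (Seq (for3 check)
      (Block [:: Const rz 0; Add 0 17 rz])))).

(** * Specifications of the subroutines *)

(** The summand [n.+1] skips the prefix 1^n 0 of the input word. *)
Definition addr (n u v : nat) := n.+1 + u * n + v.

Lemma addr_lt n u v : u < n -> v < n -> addr n u v < n.+1 + n * n.
Proof. by rewrite /addr; nia. Qed.

Lemma load_arc_reg r u v s x :
  u \notin [:: rz; 7; 8; 9] -> v \notin [:: rz; 7; 8; 9] ->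
  x \notin [:: rz; 7; 8; 9] ->
  reg (sem (load_arc r u v) s) x =
  if x == r then mem s (addr (reg s 1) (reg s u) (reg s v)) else reg s x.
Proof.
rewrite !inE !negb_or => /and4P[uz u7 u8 u9] /and4P[vz v7 v8 v9] /and4P[xz x7 x8 x9].
case: eqVneq => [->|xr]; last by apply: sem_frame; rewrite /= !inE !negb_or x7 x8 xz x9.
rewrite /load_arc; set blk := Block [:: Add 7 7 1; _; _; _; _].
set s0 := sem (Block [:: Const 7 0]) s.
set s1 := sem (For 1 8 (Block [:: Add 7 7 u])) s0.
have s0r y : y != 7 -> reg s0 y = reg s y by move=> y7; apply: sem_frame; rewrite /= inE.
have s1r y : y != 7 -> y != 8 -> y != rz -> reg s1 y = reg s y.
  move=> y7 y8 yz; rewrite -s0r //; apply: sem_frame => /=.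
  by rewrite !inE !negb_or y8 yz y7.
have s17 : reg s1 7 = reg s u * reg s 1.
  (* The counter runs down from n, so [k] is the number of additions still to come. *)
  pose P k x := x + reg s u * k = reg s u * reg s 1.
  suff : P 0 (reg s1 7) by rewrite /P muln0 addn0.
  apply: (for_ind (o := reg^~ 7)) => //; rewrite /P.
  - by move=> s2 s3 _ h; apply: h.
  - by rewrite (s0r 1) // /s0; case: (s).
  - move=> k s2 _ _ fr _; have : reg s2 u = reg s u.
      by rewrite fr ?s0r //= !inE !negb_or u8 uz u7.
    case: s2 fr => l R M /= _ -> e; rewrite -e; nia.
have s1m : mem s1 = mem s by rewrite /s1 /s0 !sem_mem.
have -> : reg (sem (Seq (Block [:: Const 7 0]) (Seq (For 1 8 (Block [:: Add 7 7 u])) blk)) s) r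
   = reg (sem blk s1) r by [].
rewrite -(s1r v) // -s1m; have := s1r 1 isT isT isT; move: s17.
case: s1 {s1r s1m} => l R M /= -> ->; rewrite !eqxx (negPf v7) /=.
by congr (M _); rewrite /addr; lia.
Qed.

Lemma load_arc_mem r u v s : mem (sem (load_arc r u v) s) = mem s.
Proof. exact: sem_mem. Qed.

(** [for_all] is applied once per nested loop, with [Q] quantified over the inner indices; register
    1 is unchanged, so all loops have the same range. *)
Lemma for3_all c (T : Type) (o : config -> T) (le : T -> T -> Prop)
    (Q : nat -> nat -> nat -> T -> Prop) s :
  wf 1 (for3 c) -> 1 \notin writes c ->
  (forall s1 s2, mem s1 = mem s2 ->
     (forall r, r \notin [:: rz; 3; 4; 5] -> reg s1 r = reg s2 r) -> o s1 = o s2) ->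
  (forall x, le x x) -> (forall y x z, le x y -> le y z -> le x z) ->
  (forall v u w x y, Q v u w x -> le x y -> Q v u w y) ->
  (forall v u w s1, v < reg s 1 -> u < reg s 1 -> w < reg s 1 ->
     reg s1 3 = v -> reg s1 4 = u -> reg s1 5 = w ->
     (forall r, r \notin [:: rz, 3, 4, 5 & writes c] -> reg s1 r = reg s r) ->
     (keeps_mem c -> mem s1 = mem s) ->
     le (o s) (o s1) -> le (o s1) (o (sem c s1)) /\ Q v u w (o (sem c s1))) ->
  le (o s) (o (sem (for3 c) s)) /\
  forall v u w, v < reg s 1 -> u < reg s 1 -> w < reg s 1 ->
    Q v u w (o (sem (for3 c) s)).
Proof.
move=> wfc c1 ho lexx letr Qle step.
have ho' i : i \in [:: 3; 4; 5] -> forall s1 s2, mem s1 = mem s2 ->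
    (forall r, r != i -> r != rz -> reg s1 r = reg s2 r) -> o s1 = o s2.
  move=> i3 s1 s2 hm hr; apply: ho => // r.
  rewrite !inE !negb_or => /and4P[r2 r3 r4 r5]; apply: hr => //.
  by move: i3; rewrite !inE => /or3P[] /eqP->.
case/and5P: (wfc) => _ _ _ n3 wf4; case/and5P: (wf4) => _ _ _ n4 wf5.
case/and5P: (wf5) => _ _ _ n5 _.
suff [h1 h2] : le (o s) (o (sem (for3 c) s)) /\ forall v, v < reg s 1 ->
    forall u, u < reg s 1 -> forall w, w < reg s 1 -> Q v u w (o (sem (for3 c) s)).
  by split=> // *; apply: h2.
apply: (for_all (Q := fun v x => forall u, u < reg s 1 -> forall w, w < reg s 1 -> Q v u w x)) => //.
- exact: ho'.
- by move=> v x y hQ le_xy u un w wn; apply: Qle le_xy; apply: hQ.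
move=> v s1 vn s1v fr1 km1 le1.
have s11 : reg s1 1 = reg s 1 by apply: fr1; rewrite /= !inE.
rewrite -s11.
apply: (for_all (Q := fun u x => forall w, w < reg s1 1 -> Q v u w x)) => //.
- exact: ho'.
- by move=> u x y hQ le_xy w wn; apply: Qle le_xy; apply: hQ.
move=> u s2 un s2u fr2 km2 le2.
have s21 : reg s2 1 = reg s1 1 by apply: fr2; rewrite /= !inE.
rewrite -s21.
apply: (for_all (Q := fun w x => Q v u w x)) => //.
- exact: ho'.
- by move=> w x y hQ le_xy; apply: Qle le_xy.
move=> w s3 wn s3w fr3 km3 le3.
move: n3 n4 n5; rewrite /= !inE !negb_or => /and5P[_ _ _ _ n3] /and3P[_ _ n4] n5.
apply: step => //.
- by rewrite -s11.
- by rewrite -s11 -s21.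
- by rewrite fr3 ?fr2 //= !inE ?negb_or.
- by rewrite fr3.
- move=> r; rewrite !inE !negb_or => /and5P[r2 r3 r4 r5 rc].
  by rewrite fr3 ?fr2 ?fr1 //= !inE !negb_or ?r2 ?r3 ?r4 ?r5.
- by move=> kc; rewrite km3 // km2 // km1.
exact: letr (letr _ _ _ le1 le2) le3.
Qed.

Lemma find_order_spec s n :
  n < reg s 0 -> (forall i, i < n -> mem s i != 0) -> mem s n = 0 ->
  reg (sem find_order s) 1 = n.
Proof.
move=> nm Mlt Mn.
(* Nothing is claimed before cell n is read; there register 1 becomes n, and the nonzero cells below
   leave it alone. *)
pose P k x := k <= n -> x = n.
suff : P 0 (reg (sem find_order s) 1) by apply.
apply: (for_ind (o := reg^~ 1)) => //; rewrite /P; first by move=> s1 s2 _ h; apply: h.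
  by rewrite leqNgt nm.
move=> k s1 km s1k _ /(_ isT) s1m IH kn.
case: s1 s1k s1m IH => l R M /= Rk -> IH; rewrite Rk.
case: eqP => /= Mk; last first.
  have {}kn : k = n by apply/eqP; rewrite eqn_leq kn leqNgt; apply/negP => /Mlt /eqP; lia.
  by rewrite kn addn0.
by apply: IH; rewrite ltn_neqAle kn andbT; apply: contra_eq_neq Mk => ->; rewrite Mn.
Qed.

Lemma init_labels_spec s :
  (forall a, a < reg s 0 -> mem (sem init_labels s) a = mem s a) /\
  (forall x, x < reg s 1 -> mem (sem init_labels s) (reg s 0 + x) = x).
Proof.
pose P k (M : nat -> nat) := (forall a, a < reg s 0 -> M a = mem s a) /\
  forall x, k <= x < reg s 1 -> M (reg s 0 + x) = x.
suff : P 0 (mem (sem init_labels s)) by [].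
apply: (for_ind (o := mem)) => //; first by split=> // x; lia.
move=> k s1 kn s1k fr _; have := fr 0 isT.
case: s1 s1k {fr} => l R M /= Rk R0 [PM PL]; rewrite Rk R0.
split=> [a am | x kx] /=; first by rewrite ifN ?PM // neq_ltn ltn_addl.
by case: eqP => [|xk]; [lia | apply: PL; lia].
Qed.

Lemma relabel_spec s :
  let M' := mem (sem relabel s) in
  (forall a, a < reg s 0 -> M' a = mem s a) /\
  (forall x, x < reg s 1 ->
     M' (reg s 0 + x) = if mem s (reg s 0 + x) == reg s 13 then reg s 12
                        else mem s (reg s 0 + x)).
Proof.
(* The update is in place: the second clause says that cells still to be visited hold their original
   labels. *)
pose P k (M : nat -> nat) := [/\ forall a, a < reg s 0 -> M a = mem s a,
  forall x, x < k -> M (reg s 0 + x) = mem s (reg s 0 + x) &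
  forall x, k <= x < reg s 1 -> M (reg s 0 + x) =
     if mem s (reg s 0 + x) == reg s 13 then reg s 12 else mem s (reg s 0 + x)].
suff : P 0 (mem (sem relabel s)) by case=> *; split.
apply: (for_ind (o := mem)) => //; first by split=> // x; lia.
move=> k s1 kn s1k fr _; have := (fr 0 isT, fr 12 isT, fr 13 isT).
case: s1 s1k {fr} => l R M /= Rk [[R0 R12] R13] [PM PU PL].
rewrite Rk R0 R13 (addnC k) PU // subn_eq0 leqNgt ltnS leqn0 addn_eq0 !subn_eq0 -eqn_leq.
case: eqVneq => /= eqk; (split=> [a am | x xk | x xk] /=).
- by rewrite ifN ?PM //; lia.
- by rewrite ifN ?PU //; lia.
- case: (eqVneq x k) => [->|xk']; first by rewrite !eqxx eqk eqxx.
  by rewrite ifN ?PL //; lia.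
- exact: PM.
- by apply: PU; lia.
case: (eqVneq x k) => [->|xk']; first by rewrite PU // (negPf eqk).
by rewrite PL //; lia.
Qed.

Definition label_at (m : nat) (M : nat -> nat) (x : nat) := M (m + x).

Lemma merge_spec s v u w (m := reg s 0) (n := reg s 1)
    (s' := sem merge s) (L := label_at m (mem s)) (L' := label_at m (mem s')) :
  v < n -> u < n -> w < n -> n.+1 + n * n <= m ->
  reg s 3 = v -> reg s 4 = u -> reg s 5 = w ->
  (forall a, a < m -> mem s' a = mem s a) /\
  forall x, x < n -> L' x =
    if [&& mem s (addr n u v) != 0, mem s (addr n w v) != 0 & L x == L w]
    then L u else L x.
Proof.
move=> vn un wn nm s3 s4 s5; rewrite {}/L' {}/s' /label_at /merge.
set s1 := sem (load_arc 10 4 3) s; set s2 := sem (load_arc 11 5 3) s1.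
have s2m : mem s2 = mem s by rewrite /s2 load_arc_mem /s1 load_arc_mem.
have s2r x : x \notin [:: rz; 7; 8; 9; 10; 11] -> reg s2 x = reg s x.
  rewrite !inE !negb_or => /and5P[x2 x7 x8 x9 /andP[x10 x11]].
  by rewrite /s2 /s1 !load_arc_reg ?inE ?negb_or ?x2 ?x7 ?x8 ?(negPf x10) ?(negPf x11).
have s2_11 : reg s2 11 = mem s (addr n w v).
  by rewrite /s2 /s1 load_arc_reg //= load_arc_mem !load_arc_reg //= s3 s5.
have s2_10 : reg s2 10 = mem s (addr n u v).
  by rewrite /s2 /s1 !load_arc_reg //= s3 s4.
rewrite -s2_10 -s2_11 /L /label_at.
have -> : sem (Seq (load_arc 10 4 3) (Seq (load_arc 11 5 3)
    (If 10 (If 11 (Seq (load_label 12 4) (Seq (load_label 13 5) relabel)))))) s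
  = if reg s2 10 == 0 then s2 else if reg s2 11 == 0 then s2 else
    sem relabel (sem (load_label 13 5) (sem (load_label 12 4) s2)) by [].
case: eqVneq => _; first by rewrite s2m.
case: eqVneq => _; first by rewrite s2m.
set s3' := sem (load_label 13 5) _; have [] := relabel_spec s3'.
have [-> ->] : reg s3' 0 = m /\ reg s3' 1 = n.
  by rewrite /m /n -!s2r // /s3'; case: (s2).
have [-> ->] : reg s3' 12 = mem s (m + u) /\ reg s3' 13 = mem s (m + w).
  rewrite /m -s4 -s5 -!s2r // -s2m /s3'; case: (s2) => ? ? ? /=.
  by split; congr (_ _); apply: addnC.
have -> : mem s3' = mem s by rewrite -s2m /s3'; case: (s2).
by split.
Qed.

(** The alternatives violate, in order, properness, the out-in and the out-out requirement. Testing
    [g u w] in one direction suffices, since both orders of a pair occur among the triples. *)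
Definition conflict (g : rel nat) (L : nat -> nat) (v u w : nat) :=
  (L u == L w) && [|| g u w | g v u && (g w v || g v w && (u != w))].

Lemma check_spec s v u w (m := reg s 0) (n := reg s 1) :
  reg s 3 = v -> reg s 4 = u -> reg s 5 = w ->
  reg (sem check s) 17 =
  if conflict (fun a b => mem s (addr n a b) != 0) (label_at m (mem s)) v u w
  then 0 else reg s 17.
Proof.
move=> s3 s4 s5; rewrite /check.
set c1 := If 15 _; set c2 := Block _; set c := Seq (load_label 12 4) _.
have -> : sem (Seq (load_arc 10 4 5) (Seq (load_arc 11 3 4)
    (Seq (load_arc 18 5 3) (Seq (load_arc 19 3 5) c)))) s =
  sem c (sem (load_arc 19 3 5) (sem (load_arc 18 5 3) (sem (load_arc 11 3 4)
    (sem (load_arc 10 4 5) s)))) by [].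
set s' := sem (load_arc 19 3 5) _.
have [E0 E3 E4 E5] : [/\ reg s' 0 = m, reg s' 3 = v, reg s' 4 = u & reg s' 5 = w].
  by rewrite /s' !load_arc_reg //= !load_arc_mem.
have [E10 E11 E18 E19] : [/\ reg s' 10 = mem s (addr n u w),
   reg s' 11 = mem s (addr n v u), reg s' 18 = mem s (addr n w v) &
   reg s' 19 = mem s (addr n v w)].
  by rewrite /s' !(load_arc_reg, load_arc_mem) //= s3 s4 s5.
have E17 : reg s' 17 = reg s 17 by rewrite /s' !load_arc_reg.
have Em : mem s' = mem s by rewrite /s' !load_arc_mem.
rewrite /conflict -E10 -E11 -E18 -E19 -E17 /label_at -Em.
clearbody s'.
have -> : sem c s' = sem c1 (sem c2 (sem (load_label 13 5) (sem (load_label 12 4) s'))) by [].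
set t := sem c2 _.
have [T15 T20] : (reg t 15 == 0) = (mem s' (m + u) != mem s' (m + w)) /\
    (reg t 20 == 0) = (u == w).
  rewrite {}/t; case: s' E0 E4 E5 {E3 E10 E11 E18 E19 E17 Em} => l R M /= E0 E4 E5.
  rewrite E0 E4 E5 (addnC u) (addnC w) !addn_eq0 !subn_eq0 -!eqn_leq.
  by split=> //; rewrite lt0n addn_eq0 !subn_eq0 -eqn_leq.
have [-> -> -> -> ->] : [/\ reg s' 10 = reg t 10, reg s' 11 = reg t 11,
    reg s' 18 = reg t 18, reg s' 19 = reg t 19 & reg s' 17 = reg t 17].
  by rewrite /t; case: (s').
clearbody t; rewrite -T20; move: T15; case: t {T20} => l R M /= ->; case: eqVneq => //= _.
by case: (R 10 == 0); case: (R 11 == 0) => //=; case: (R 18 == 0);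
  case: (R 19 == 0) => //=; case: (R 20 == 0).
Qed.

(** * Invariants of the merging and checking loops *)

Definition agrees_on_in (n : nat) (g : rel nat) (F : nat -> nat) :=
  forall v u w, v < n -> u < n -> w < n -> g u v -> g w v -> F u = F w.

(** The last two clauses say that the final labelling is the finest one constant on
    in-neighbourhoods: every other such map factors through it. *)
Lemma for3_merge_spec s (m := reg s 0) (n := reg s 1) (s' := sem (for3 merge) s)
    (g := fun a b => mem s (addr n a b) != 0) (L' := label_at m (mem s')) :
  n.+1 + n * n <= m -> (forall x, x < n -> label_at m (mem s) x = x) ->
  [/\ forall a, a < m -> mem s' a = mem s a,
      agrees_on_in n g L' &
      forall F, agrees_on_in n g F ->
        forall x y, x < n -> y < n -> L' x = L' y -> F x = F y].
Proof.
move=> nm L0.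
pose sound M := forall F, agrees_on_in n g F -> forall x y, x < n -> y < n ->
  label_at m M x = label_at m M y -> F x = F y.
(* Soundness enters as an implication, which makes [le] a preorder; it is discharged at the initial
   memory. *)
pose le (M M' : nat -> nat) := [/\ forall a, a < m -> M' a = M a,
  forall x y, x < n -> y < n -> label_at m M x = label_at m M y ->
    label_at m M' x = label_at m M' y &
  sound M -> sound M'].
pose Q v u w (M : nat -> nat) := u < n -> w < n -> g u v -> g w v ->
  label_at m M u = label_at m M w.
suff [[h1 _ h2] h3] : le (mem s) (mem s') /\ forall v u w, v < n -> u < n -> w < n ->
    Q v u w (mem s').
  split=> //; first by move=> v u w vn un wn; apply: h3.
  (* Initially each vertex is its own label, so equal labels mean equal vertices. *)
  by apply: h2 => F _ x y xn yn; rewrite !L0 // => ->.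
apply: (for3_all (o := mem)) => //.
- move=> y x z [a1 b1 c1] [a2 b2 c2]; split=> [a am|i j im jm /b1 h|/c1/c2//].
    by rewrite a2 ?a1.
  by apply: b2 => //; apply: h.
- by move=> v u w x y hQ [_ h _] un wn guv gwv; apply: h => //; apply: hQ.
move=> v u w s1 vn un wn s1v s1u s1w fr _ [s1m _ _].
have s1_0 : reg s1 0 = m by rewrite fr.
have s1_1 : reg s1 1 = n by rewrite fr.
have [] := @merge_spec s1 v u w; rewrite ?s1_0 ?s1_1 //.
rewrite !(s1m (addr n _ _)) ?(leq_trans (addr_lt _ _)) //.
set M' := mem (sem merge s1) => low high.
split; last by move=> _ _ guv gwv; rewrite !high // -/(g u v) -/(g w v) guv gwv eqxx; case: ifP.
split=> // [x y xn yn exy|h F hF x y xn yn]; first by rewrite !high // exy.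
rewrite !high // -/(g u v) -/(g w v); have hL := h F hF.
case: (boolP (g u v)) => guv /=; last exact: hL.
case: (boolP (g w v)) => gwv /=; last exact: hL.
(* Labels that become equal only now come from the old classes of u and w, on which [F] takes the
   same value. *)
have Fuw : F u = F w by apply: hF guv gwv.
case: eqP => [xw|_]; case: eqP => [yw|_]; try exact: hL.
- by move=> _; apply: hL; rewrite ?xw ?yw.
- by move=> uy; rewrite (hL x w) // -Fuw; apply: hL.
by move=> xu; rewrite (hL y w) // -Fuw; apply: hL.
Qed.

Lemma for3_check_spec s (m := reg s 0) (n := reg s 1)
    (g := fun a b => mem s (addr n a b) != 0) (L := label_at m (mem s)) :
  reg s 17 = 1 ->
  reg (sem (for3 check) s) 17 != 0 <->
  forall v u w, v < n -> u < n -> w < n -> ~~ conflict g L v u w.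
Proof.
move=> s17.
pose ok := forall v u w, v < n -> u < n -> w < n -> ~~ conflict g L v u w.
(* A verdict once cleared stays cleared, and without conflicts it is never cleared. *)
pose le x y := (y != 0 -> x != 0) /\ (ok -> x != 0 -> y != 0).
suff [[_ h1] h2] : le (reg s 17) (reg (sem (for3 check) s) 17) /\
   forall v u w, v < n -> u < n -> w < n ->
    reg (sem (for3 check) s) 17 != 0 -> ~~ conflict g L v u w.
  by split=> [h v u w vn un wn|h]; [apply: h2 | apply: h1; rewrite ?s17].
apply: (for3_all (o := reg^~ 17) (Q := fun v u w x => x != 0 -> ~~ conflict g L v u w)) => //.
- by move=> s1 s2 _ h; apply: h.
- by move=> y x z [h1 h2] [h3 h4]; split=> [/h3/h1//|ok' /h2 h]; apply/h4/h.
- by move=> v u w x y hQ [h _] /h.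
move=> v u w s1 vn un wn s1v s1u s1w fr km _.
rewrite (check_spec s1v s1u s1w) km // (fr 0) // (fr 1) //.
by case: ifP => c; split=> //; split=> // ok'; rewrite (negPf (ok' _ _ _ vn un wn)) in c.
Qed.

Definition arc_of (x : bitseq) (n : nat) : rel nat := fun u v => nth false x (addr n u v).

(** The witness [L] is the labelling left in memory by the merging loops; those loops preserve the
    input, so the check sees the original arcs. *)
Lemma decide_spec x n (g := arc_of x n) (s := sem decide (sem find_order (init x))) :
  (forall i, i < n -> nth false x i) -> nth false x n = false ->
  size x = n.+1 + n * n ->
  exists L, [/\ agrees_on_in n g L,
    forall F, agrees_on_in n g F ->
      forall x y, x < n -> y < n -> L x = L y -> F x = F y &
    reg s 0 != 0 <-> forall v u w, v < n -> u < n -> w < n -> ~~ conflict g L v u w].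
Proof.
move=> x1 x0 sx; rewrite {}/s; set s0 := sem find_order _.
have s0_0 : reg s0 0 = size x by rewrite /s0 sem_frame.
have s0_1 : reg s0 1 = n.
  apply: find_order_spec => /= [||]; first by rewrite sx; lia.
    by move=> i /x1 ->.
  by rewrite x0.
have s0m : mem s0 = fun i => nth false x i by rewrite /s0 sem_mem.
have [] := init_labels_spec s0; set s1 := sem init_labels s0.
have s1_0 : reg s1 0 = size x by rewrite /s1 sem_frame.
have s1_1 : reg s1 1 = n by rewrite /s1 sem_frame.
rewrite s0_0 s0_1 s0m => s1m s1L.
have [] := @for3_merge_spec s1; rewrite ?s1_0 ?s1_1 //; first by rewrite sx.
set s2 := sem (for3 merge) s1 => s2m agr fin.
have s2_0 : reg s2 0 = size x by rewrite /s2 sem_frame.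
have s2_1 : reg s2 1 = n by rewrite /s2 sem_frame.
have s1g u v : u < n -> v < n -> (mem s1 (addr n u v) != 0) = g u v.
  by move=> un vn; rewrite s1m ?sx ?addr_lt // eqb0 negbK.
have agrE F : agrees_on_in n g F <-> 
    agrees_on_in n (fun u v => mem s1 (addr n u v) != 0) F.
  by split=> h v u w vn un wn; have := h v u w vn un wn; rewrite !s1g.
exists (label_at (size x) (mem s2)); split; first exact/agrE.
  by move=> F /agrE/fin.
set s3 := sem (Block [:: Const 17 1]) s2.
have s3_0 : reg s3 0 = size x by rewrite /s3 sem_frame.
have s3_1 : reg s3 1 = n by rewrite /s3 sem_frame.
have s3m : mem s3 = mem s2 by rewrite /s3 sem_mem.
have s3_17 : reg s3 17 = 1 by rewrite /s3; case: (s2).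
have := for3_check_spec s3_17; rewrite s3_0 s3_1 s3m.
have -> : reg (sem decide s0) 0 = reg (sem (for3 check) s3) 17.
  have -> : sem decide s0 = sem (Block [:: Const rz 0; Add 0 17 rz]) (sem (for3 check) s3) by [].
  by case: (sem _ s3) => l R M /=; rewrite addn0.
move=> ->; split=> h v u w vn un wn; have := h v u w vn un wn;
  by rewrite /conflict !s2m ?sx ?addr_lt // !s1g.
Qed.

(** * Correctness of the algorithm *)

Lemma nth_allpairs (S T R : Type) (f : S -> T -> R) s t x0 y0 z0 i j :
  i < size s -> j < size t ->
  nth z0 [seq f x y | x <- s, y <- t] (i * size t + j) = f (nth x0 s i) (nth y0 t j).
Proof.
elim: s i => // x s IHs [|i] /= si tj; rewrite nth_cat size_map.
  by rewrite mul0n add0n tj (nth_map y0).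
by rewrite mulSn -addnA ltnNge leq_addr addKn IHs.
Qed.

Lemma size_encode D : size (encode D) = (nverts D).+1 + nverts D * nverts D.
Proof. by rewrite /encode size_cat size_nseq /= size_allpairs size_enum_ord addnS. Qed.

Lemma nth_encode_order D i : i <= nverts D -> nth false (encode D) i = (i < nverts D).
Proof.
rewrite /encode nth_cat size_nseq nth_nseq leq_eqVlt => /predU1P[->|->] //.
by rewrite ltnn subnn.
Qed.

Lemma arc_of_encode D (u v : 'I_(nverts D)) :
  arc_of (encode D) (nverts D) u v = arc (orient D) u v.
Proof.
rewrite /arc_of /encode /addr nth_cat size_nseq ltnNge -addnA addSnnS leq_addr addKn /=.
have := @nth_allpairs _ _ _ (fun u v => arc (orient D) u v) (enum 'I_(nverts D))
  (enum 'I_(nverts D)) u v false u v.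
by rewrite size_enum_ord !nth_ord_enum => ->.
Qed.

(** If [L] has no conflict, it is itself the desired colouring. Conversely a MINI colouring factors
    through [L], so a conflict of [L] would be one of the colouring. *)
Lemma coloured_MINI_conflict_free D (g := arc_of (encode D) (nverts D)) L :
  agrees_on_in (nverts D) g L ->
  (forall F, agrees_on_in (nverts D) g F ->
     forall x y, x < nverts D -> y < nverts D -> L x = L y -> F x = F y) ->
  (forall v u w, v < nverts D -> u < nverts D -> w < nverts D -> ~~ conflict g L v u w) <->
  exists q : nat, 0 < q /\ exists f : 'I_(nverts D) -> 'I_q, coloured_MINI (orient D) f.
Proof.
set n := nverts D => Lin Lfin; have gE (u v : 'I_n) : g u v = arc (orient D) u v.
  exact: arc_of_encode.
have adjP (u v : 'I_n) : adj (ugraph D) u v -> g u v || g v u.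
  by move/(arc_exactly_one (orient D)); rewrite !gE; case: (arc _ u v).
split=> [nc|[q [q0 [f [fcol foi foo fii]]]] v u w vn un wn].
  (* One more than the largest label: all labels fit into ['I_q], and [q] is positive even without
     vertices. *)
  pose q := (\max_(u < n) L u).+1; exists q; split=> //.
  have fL (u w : 'I_n) : (inord (L u) : 'I_q) = inord (L w) -> L u = L w.
    by move/(congr1 val); rewrite /= !inordK // ltnS; apply: leq_bigmax.
  have ncE (v u w : 'I_n) := nc v u w (ltn_ord v) (ltn_ord u) (ltn_ord w).
  exists (fun u => inord (L u)); split=> [u w /adjP/orP[] h /fL e|v u w vu wv /fL e
      |v u w vu vw uw /fL e|v u w uv wv].
  (* Properness concerns only two vertices, so an endpoint fills the place of [v]; the two cases are
     the two directions of the arc. *)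
  - by have := ncE u u w; rewrite /conflict e eqxx h.
  - by have := ncE u w u; rewrite /conflict e eqxx h.
  - by have := ncE v u w; rewrite /conflict e eqxx !gE vu wv !orbT.
  - have := ncE v u w; rewrite /conflict e eqxx !gE vu vw (_ : (val u != val w) = true) ?orbT //.
    by apply/eqP => /val_inj.
  by rewrite (Lin v u w) // gE.
(* The colouring is extended to all natural numbers by the default 0. *)
pose F k := oapp (fun i => val (f i)) 0 (insub k).
have FE (i : 'I_n) : F i = f i by rewrite /F valK.
have Fin : agrees_on_in n g F.
  move=> {}v {}u {}w {}vn {}un {}wn.
  rewrite -[v]/(val (Ordinal vn)) -[u]/(val (Ordinal un)) -[w]/(val (Ordinal wn)).
  by rewrite !gE !FE => uv wv; rewrite (fii _ _ _ uv wv).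
apply/negP => /andP[/eqP/(Lfin F Fin _ _ un wn)].
rewrite -[v]/(val (Ordinal vn)) -[u]/(val (Ordinal un)) -[w]/(val (Ordinal wn)).
rewrite !FE !gE => /val_inj e /orP[uw|].
  exact: fcol (arc_adj uw) e.
case/andP=> vu /orP[wv|/andP[vw uw]]; first exact: foi vu wv e.
by apply: foo vu vw _ e => uw'; rewrite uw' eqxx in uw.
Qed.

Theorem theorem18 :
  poly_time_decidable encode
    (fun D : oriented_graph =>
       exists q : nat, 0 < q /\
       exists f : 'I_(nverts D) -> 'I_q, coloured_MINI (orient D) f).
Proof.
(* Two separate compilations: the first loop is bounded by the input length in register 0, the
   others by n in register 1, known only after the first. *)
pose p1 := compile 0 find_order; pose p2 := compile (size p1) decide.
exists (p1 ++ p2), (time find_order + time decide)%R => D.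
set x := encode D; set s1 := sem find_order (init x); set n := nverts D.
have [L [Lin Lfin LP]] : exists L, [/\ agrees_on_in n (arc_of x n) L,
    forall F, agrees_on_in n (arc_of x n) F ->
      forall x y, x < n -> y < n -> L x = L y -> F x = F y &
    reg (sem decide s1) 0 != 0 <->
      forall v u w, v < n -> u < n -> w < n -> ~~ conflict (arc_of x n) L v u w].
  apply: decide_spec; last exact: size_encode.
    by move=> i ni; rewrite nth_encode_order ?ni // ltnW.
  by rewrite nth_encode_order // ltnn.
exists (setpc (size (p1 ++ p2)) (sem decide s1)).
split; last exact: (iff_trans LP (coloured_MINI_conflict_free Lin Lfin)).
have s1_1 : reg s1 1 = n.
  apply: find_order_spec => /= [|i ni|].
  - by rewrite size_encode; lia.
  - by rewrite nth_encode_order ?ni // ltnW.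
  by rewrite nth_encode_order // ltnn.
rewrite /halts_within.
suff [k kt kE] : reaches (p1 ++ p2) (time find_order + time decide).[size x]%R
    (setpc 0 (init x)) (setpc (size (p1 ++ p2)) (sem decide s1)).
  by exists k; split; rewrite // -?kE /halted.
rewrite hornerD size_cat.
have c1 : code_at (p1 ++ p2) 0 p1 /\ code_at (p1 ++ p2) (size p1) p2.
  by apply: (@code_at_cat (p1 ++ p2) 0).
apply: reaches_trans (compile_correct (b := 0) _ _ c1.1 _)
  (compile_correct (b := 1) _ _ c1.2 _) (leqnn _) => //.
(* As n is at most the input length, that length is also a valid bound for register 1. *)
by rewrite s1_1 size_encode; lia.
Qed.
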